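(* Let $s_1\ge 2$ be an integer and let $S=\{1,2,\ldots,s_1\}$ (cumulative subtraction with full support). Then $\mathrm{opt}(x)=x$ for every position $1\le x<s_1$, and $\mathrm{opt}(x)=s_1$ for every position $x\ge s_1$. That is, the game $S$ converges at $s_1$ (i.e. $\xi(S)=s_1$). Moreover, its outcome sequence $o(0),o(1),o(2),\ldots$ is periodic with the pattern $$(0,1,\ldots,s_1,s_1-1,\ldots,1),$$ i.e. for all integers $k\ge 0$, $o(2ks_1+x)=x$ for $0\le x\le s_1$ and $o(2ks_1+s_1+x)=s_1-x$ for $0\le x\le s_1$.
   Context: Cumulative subtraction (CS): $S$ is a finite set of positive integers with $|S|\ge 2$. Starting from a heap of $x\in\mathbb{Z}_{\ge 0}$ pebbles and score $0$, two players, Positive (who starts) and Negative, alternate in removing $s\in S$ pebbles, with $s$ at most the current heap size; Positive's move adds $s$ to the score and Negative's move subtracts $s$. The game ends when the heap is smaller than $\min S$. Positive maximizes and Negative minimizes the terminal score. Outcome function: $o:\mathbb{Z}_{\ge 0}\to\mathbb{Z}$ is defined recursively by $o(x)=0$ if $x<\min S$ and $o(x)=\max\{s-o(x-s)\mid s\in S,\ s\le x\}$ if $x\ge\min S$. Optimal action: for $x\ge\min S$, $\mathrm{opt}(x)$ is the largest $s\in S$ with $s\le x$ and $o(x)=s-o(x-s)$. Convergence: the game $S$ converges at position $x>0$ if $\mathrm{opt}(y)$ is constant over all $y\ge x$, but $\mathrm{opt}(x-1)\neq\mathrm{opt}(y)$ for $y\ge x$; this $x$ is denoted $\xi(S)$.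 *)

(* Defs.v *)
From HB Require Import structures.
From mathcomp Require Import all_boot all_order all_algebra.
From mathcomp Require Import finmap.

Set Implicit Arguments.
Unset Strict Implicit.
Unset Printing Implicit Defensive.

Import Order.TTheory GRing.Theory Num.Theory.
Local Open Scope ring_scope.

Definition subtraction_set (S : {fset nat}) : bool :=
  (0%N \notin S) && (1 < #|` S|)%N.

(* The seeds of the two folds below belong to the list as soon as it is
   nonempty, so these are its genuine minimum and maximum. *)
Definition min_supp (S : {fset nat}) : nat :=
  \big[minn/head 0%N S]_(s <- S) s.

Definition maxz (l : seq int) : int :=
  \big[Order.max/head 0 l]_(z <- l) z.

(* Recursion on a bound n > x for the heap size. *)
Fixpoint outcome_rec (S : {fset nat}) (n x : nat) : int :=
  if n is n'.+1 then
    if (x < min_supp S)%N then 0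
    else maxz [seq s%:Z - outcome_rec S n' (x - s)%N
              | s <- S & (s <= x)%N]
  else 0.

Definition outcome (S : {fset nat}) (x : nat) : int := outcome_rec S x.+1 x.

(* The optimal action is only meaningful for min S <= x; for smaller x the
   range is empty and the value is 0, which is not an action. *)
Definition opt (S : {fset nat}) (x : nat) : nat :=
  \max_(s <- S | (s <= x)%N && (outcome S x == s%:Z - outcome S (x - s))) s.

(* "xi(S) = x"; such an x is unique by converges_at_inj. *)
Definition converges_at (S : {fset nat}) (x : nat) : Prop :=
  [/\ (0 < x)%N,
      forall y z : nat, (x <= y)%N -> (x <= z)%N -> opt S y = opt S z
    & forall y : nat, (x <= y)%N -> opt S x.-1 <> opt S y].

Definition full_support (s1 : nat) : {fset nat} := [fset s in iota 1 s1]%fset.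

Definition periodic_with_pattern (o : nat -> int) (p : seq int) : Prop :=
  forall x : nat, o x = nth 0 p (x %% size p).

(* (0, 1, ..., s1, s1 - 1, ..., 1), of length 2 * s1 when s1 > 0 *)
Definition triangle_pattern (s1 : nat) : seq int :=
  [seq i%:Z | i <- iota 0 s1.+1 ++ rev (iota 1 s1.-1)].

Lemma full_support_subtraction_set (s1 : nat) :
  (2 <= s1)%N -> subtraction_set (full_support s1).
Proof.
move=> s1_ge2; apply/andP; split; first by rewrite !inE mem_iota.
by rewrite card_fseq undup_id ?iota_uniq // size_iota.
Qed.

Lemma mem_full_support (s1 s : nat) :
  (s \in full_support s1) = (1 <= s <= s1)%N.
Proof. by rewrite !inE mem_iota add1n ltnS. Qed.

Lemma min_supp_in (S : {fset nat}) : S != fset0 -> min_supp S \in S.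
Proof.
case/fset0Pn => s0 s0S; rewrite /min_supp.
have hS : head 0%N S \in S.
  have : s0 \in enum_fset S by [].
  suff: forall l : seq nat, s0 \in l -> head 0%N l \in l by apply.
  by case=> // a l _; rewrite mem_head.
rewrite big_seq; apply: (big_ind (fun m => m \in S)) => // x y xS yS.
by rewrite /minn; case: ifP.
Qed.

Lemma min_supp_le (S : {fset nat}) (s : nat) : s \in S -> (min_supp S <= s)%N.
Proof.
rewrite /min_supp => sS; have {sS} : s \in enum_fset S by [].
elim: (enum_fset S) (head _ _) => // a l IH h; rewrite big_cons inE geq_min.
by case/predU1P=> [->|/IH ->]; rewrite ?leqnn ?orbT.
Qed.

Lemma maxz_in (l : seq int) : l != [::] -> maxz l \in l.
Proof.
move=> ln0; rewrite /maxz big_seq.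
apply: (big_ind (fun m => m \in l)) => // [|x y xl yl].
  by case: l ln0 => // a l _; rewrite mem_head.
by rewrite /Order.max; case: ifP.
Qed.

Lemma maxz_ge (l : seq int) (z : int) : z \in l -> z <= maxz l.
Proof.
rewrite /maxz; elim: l (head _ _) => // a l IH h; rewrite big_cons inE le_max.
by case/predU1P=> [->|/IH ->]; rewrite ?lexx ?orbT.
Qed.

Lemma outcomeE (S : {fset nat}) (x : nat) : 0%N \notin S ->
  outcome S x = if (x < min_supp S)%N then 0
    else maxz [seq s%:Z - outcome S (x - s) | s <- S & (s <= x)%N].
Proof.
move=> S0; have indep n m y : (y < n)%N -> (y < m)%N ->
    outcome_rec S n y = outcome_rec S m y.
  elim: n m y => // n IH [] // m y; rewrite !ltnS => yn ym /=.
  case: ifP => // _; congr maxz; apply/eq_in_map => s.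
  rewrite mem_filter => /andP[sy sS].
  have s0 : (0 < s)%N by rewrite lt0n; apply: contraNneq S0 => <-.
  by congr (_ - _); apply: IH;
     [apply: leq_trans yn | apply: leq_trans ym];
     rewrite ltn_subrL s0 (leq_trans s0 sy).
rewrite {1}/outcome /=; case: ifP => // _; congr maxz; apply/eq_in_map => s.
rewrite mem_filter => /andP[sx sS]; congr (_ - _); apply: indep => //.
have s0 : (0 < s)%N by rewrite lt0n; apply: contraNneq S0 => <-.
by rewrite ltn_subrL s0 (leq_trans s0 sx).
Qed.

Lemma converges_at_inj (S : {fset nat}) (x y : nat) :
  converges_at S x -> converges_at S y -> x = y.
Proof.
wlog lt_xy : x y / (x < y)%N => [W cx cy|[_ cx _] [y0 _ cy]].
  by case: (ltngtP x y) => // ?; [apply: W|apply/esym/W].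
case: (cy _ (leqnn y)); apply: cx; last exact: ltnW.
by rewrite -ltnS prednK.
Qed.

(* Main.v *)
Require Import Defs.
From HB Require Import structures.
From mathcomp Require Import all_boot all_order all_algebra.
From mathcomp Require Import finmap.
From mathcomp Require Import zify.

(** The outcome at [x] is the distance [d x] from [x] to the nearest multiple
    of [2 * s1].  Since [d] is even and subadditive and [d s = s] for [s <= s1], every
    move satisfies [s - d (x - s) <= d x].  Equality holds for the largest legal
    move [minn x s1]: it leads to [0] when [x <= s1], and otherwise the
    antiperiodicity [d (x - s1) = s1 - d x] applies. *)

Set Implicit Arguments.
Unset Strict Implicit.
Unset Printing Implicit Defensive.

Import Order.TTheory GRing.Theory Num.Theory.
Local Open Scope ring_scope.

(** The function [d] of the overview, with [n] for [s1]. At [n = 0] the residue is [x] and the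
    truncated difference is [0], so the wave vanishes. *)
Definition triangle_wave (n x : nat) : nat :=
  (minn (x %% (2 * n)) (2 * n - x %% (2 * n)))%N.

Lemma triangle_wave_small (n x : nat) : (x <= n)%N -> triangle_wave n x = x.
Proof.
rewrite /triangle_wave; case: n => [|n] xn; first by rewrite modn0; lia.
by rewrite modn_small; lia.
Qed.

Lemma triangle_wave_periodic (n k x : nat) :
  (triangle_wave n (2 * k * n + x) = triangle_wave n x)%N.
Proof. by rewrite /triangle_wave mulnAC mulnC modnMDl. Qed.

(** As [y %% m + s < 2 * m], at most one subtraction of [m] reduces it. This leaves only linear
    goals in [y %% m], within reach of [lia]. *)
Lemma modnD_once (m y s : nat) : (s <= m)%N -> (0 < m)%N ->
  ((y + s) %% m = if y %% m + s < m then y %% m + s else y %% m + s - m)%N.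
Proof.
move=> sm m0; rewrite -modnDml; have rm := ltn_pmod y m0.
case: ltnP => [lt|ge]; first by rewrite modn_small.
by rewrite -{1}(subnK ge) modnDr modn_small; lia.
Qed.

(** A half-period shift swaps even and odd multiples of [n]; [x] lies between one of each, and its
    distances to the two add up to [n]. *)
Lemma triangle_wave_antiperiodic (n x : nat) :
  (triangle_wave n (x + n) = n - triangle_wave n x)%N.
Proof.
case: n => [|n]; first by rewrite /triangle_wave; lia.
have rm := @ltn_pmod x (2 * n.+1) isT.
by rewrite /triangle_wave modnD_once; [case: ifP; lia|lia..].
Qed.

Lemma triangle_wave_le (n x : nat) : (triangle_wave n x <= n)%N.
Proof. by rewrite /triangle_wave; lia. Qed.

(** The bound on a move from [x = y + s], in additive form to avoid truncated subtraction. *)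
Lemma leq_triangle_wave (n s y : nat) : (s <= n)%N ->
  (s <= triangle_wave n (y + s) + triangle_wave n y)%N.
Proof.
case: n => [|n] sn; first by rewrite (leq_trans sn).
have rm := @ltn_pmod y (2 * n.+1) isT.
by rewrite /triangle_wave modnD_once; [case: ifP; lia|lia..].
Qed.

(** Serves twice: the largest move attains the maximum defining the outcome, and it passes the
    optimality test in [opt]. *)
Lemma triangle_wave_largest_move (n x : nat) : (0 < n)%N ->
  (triangle_wave n x + triangle_wave n (x - minn x n) = minn x n)%N.
Proof.
move=> n0; case: (leqP x n) => xn.
  by rewrite subnn !triangle_wave_small // addn0.
rewrite -{1}(subnK (ltnW xn)) triangle_wave_antiperiodic.
by rewrite subnK // triangle_wave_le.
Qed.

Lemma min_supp_full (n : nat) : (0 < n)%N -> min_supp (full_support n) = 1%N.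
Proof.
move=> n0; have S1 : 1%N \in full_support n by rewrite mem_full_support n0.
apply/eqP; rewrite eqn_leq min_supp_le //.
have : min_supp (full_support n) \in full_support n.
  by apply: min_supp_in; apply/fset0Pn; exists 1%N.
by rewrite mem_full_support => /andP[].
Qed.

Lemma mem_minn_full_support (n x : nat) : (0 < n)%N -> (0 < x)%N ->
  minn x n \in full_support n.
Proof. by move=> n0 x0; rewrite mem_full_support leq_min x0 n0 geq_minr. Qed.

Lemma outcome_full_support (n x : nat) : (0 < n)%N ->
  outcome (full_support n) x = (triangle_wave n x)%:Z.
Proof.
move=> n0; elim/ltn_ind: x => x IH.
rewrite outcomeE ?mem_full_support // min_supp_full // ltnS leqn0.
case: posnP => [->|x0]; first by rewrite triangle_wave_small.
have mS := mem_minn_full_support n0 x0.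
set l := [seq _ | _ <- _ & _].
have waveP : (triangle_wave n x)%:Z \in l.
  apply/mapP; exists (minn x n); first by rewrite mem_filter geq_minl.
  have := triangle_wave_largest_move x n0.
  by rewrite IH; lia.
(* For the other inequality, the maximum is itself the value of some legal move [s], to which
   [leq_triangle_wave] applies with [y = x - s]. *)
apply/eqP; rewrite eq_le maxz_ge // andbT.
have /maxz_in/mapP[s] : l != [::] by apply: contraTneq waveP => ->.
rewrite mem_filter mem_full_support => /and3P[sx s0 sn] ->.
have := leq_triangle_wave (x - s) sn.
by rewrite subnK // IH; lia.
Qed.

(** Legality alone bounds every candidate by [minn x n], and that move is optimal. *)
Lemma opt_full_support (n x : nat) : (0 < n)%N ->
  opt (full_support n) x = minn x n.
Proof.
move=> n0; apply/eqP; rewrite eqn_leq; apply/andP; split.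
  apply/bigmax_leqP_seq => s; rewrite mem_full_support leq_min.
  by move=> /andP[_ ->] /andP[-> _].
case: (posnP x) => [->|x0]; first by rewrite min0n.
have mS := mem_minn_full_support n0 x0.
apply: (@leq_bigmax_seq _ _ _ id) => //; rewrite geq_minl /=.
have := triangle_wave_largest_move x n0.
by rewrite !outcome_full_support //; lia.
Qed.

Lemma size_triangle_pattern (n : nat) : (0 < n)%N ->
  size (triangle_pattern n) = (2 * n)%N.
Proof. by move=> n0; rewrite size_map size_cat size_rev !size_iota; lia. Qed.

Lemma nth_triangle_pattern (n r : nat) : (0 < n)%N -> (r < 2 * n)%N ->
  nth 0 (triangle_pattern n) r = (minn r (2 * n - r))%:Z.
Proof.
move=> n0 rn; rewrite (nth_map 0%N); last first.
  by rewrite size_cat size_rev !size_iota; lia.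
congr Posz; rewrite nth_cat size_iota; case: ltnP => rn1.
  by rewrite nth_iota //; lia.
(* Index [r - (n + 1)] of the reversed block is index [2 * n - r - 1] of [iota 1 n.-1], whose entry
   is [2 * n - r]. *)
by rewrite nth_rev ?size_iota ?nth_iota; lia.
Qed.

Theorem theorem6 (s1 : nat) (s1_ge2 : (2 <= s1)%N) :
  let S := full_support s1 in
  (forall x : nat, (1 <= x < s1)%N -> opt S x = x) /\
  (forall x : nat, (s1 <= x)%N -> opt S x = s1) /\
  converges_at S s1 /\
  periodic_with_pattern (outcome S) (triangle_pattern s1) /\
  (forall k x : nat, (x <= s1)%N ->
     outcome S (2 * k * s1 + x)%N = x%:Z) /\
  (forall k x : nat, (x <= s1)%N ->
     outcome S (2 * k * s1 + s1 + x)%N = s1%:Z - x%:Z).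
Proof.
have n0 : (0 < s1)%N by exact: ltnW.
move=> S; do ![split].
- by move=> x xs; rewrite opt_full_support //; lia.
- by move=> x xs; rewrite opt_full_support //; lia.
- exact: n0.
- by move=> y z sy sz; rewrite !opt_full_support //; lia.
- by move=> y sy; rewrite !opt_full_support //; lia.
- move=> x; rewrite outcome_full_support // size_triangle_pattern //.
  by rewrite nth_triangle_pattern // ltn_pmod // muln_gt0.
- by move=> k x xs; rewrite outcome_full_support // triangle_wave_periodic
    triangle_wave_small.
- move=> k x xs; rewrite outcome_full_support // -addnA triangle_wave_periodic.
  (* Since [x <= s1], the truncated difference agrees with the integer one. *)
  by rewrite addnC triangle_wave_antiperiodic triangle_wave_small // subzn.
Qed.
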